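(* Let $\Gamma=\langle\mathcal{A},\mathcal{R}\rangle$ be an AFRA and let $\Gamma_{AF}=\langle\widetilde{\mathcal{A}},\widetilde{\mathcal{R}}\rangle$ be its corresponding AF, i.e. $\widetilde{\mathcal{A}}=\mathcal{A}\cup\mathcal{R}$ and $\widetilde{\mathcal{R}}=\{(V,W)\mid V,W\in\mathcal{A}\cup\mathcal{R},\ V\rightarrow_R W\}$. Let $\mathcal{S}\subseteq\mathcal{A}\cup\mathcal{R}$ and $W\in\mathcal{A}\cup\mathcal{R}$. Then: 1. $\mathcal{S}$ is a conflict-free set for $\Gamma$ iff $\mathcal{S}$ is a D-conflict-free set for $\Gamma_{AF}$; 2. $W$ is acceptable w.r.t. $\mathcal{S}$ in $\Gamma$ iff $W$ is D-acceptable w.r.t. $\mathcal{S}$ in $\Gamma_{AF}$; 3. $\mathcal{S}$ is an admissible set for $\Gamma$ iff $\mathcal{S}$ is a D-admissible set for $\Gamma_{AF}$; 4. $\mathcal{S}$ is a preferred extension for $\Gamma$ iff $\mathcal{S}$ is a D-preferred extension for $\Gamma_{AF}$; 5. $\mathcal{S}$ is a stable extension for $\Gamma$ iff $\mathcal{S}$ is a D-stable extension for $\Gamma_{AF}$; 6. $\mathcal{S}$ is a complete extension for $\Gamma$ iff $\mathcal{S}$ is a D-complete extension for $\Gamma_{AF}$; 7. $\mathcal{S}$ is the grounded extension for $\Gamma$ iff $\mathcal{S}$ is the D-grounded extension for $\Gamma_{AF}$; 8. $\mathcal{S}$ is a semi-stable extension for $\Gamma$ iff $\mathcal{S}$ is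 a D-semi-stable extension for $\Gamma_{AF}$; 9. $\mathcal{S}$ is the ideal extension for $\Gamma$ iff $\mathcal{S}$ is the D-ideal extension for $\Gamma_{AF}$.
   Context: An AFRA (Argumentation Framework with Recursive Attacks) is a pair $\langle\mathcal{A},\mathcal{R}\rangle$ where $\mathcal{A}$ is a set (of arguments) and $\mathcal{R}$ is a set of attacks, each attack being a pair $\alpha=(A,X)$ with $A\in\mathcal{A}$ and ($X\in\mathcal{R}$ or $X\in\mathcal{A}$); $A=src(\alpha)$ is its source and $X=trg(\alpha)$ its target. Arguments and attacks are distinct objects ($\mathcal{A}\cap\mathcal{R}=\emptyset$). Defeat: for $\alpha\in\mathcal{R}$, $V\in\mathcal{A}\cup\mathcal{R}$, $\alpha$ directly defeats $V$ iff $V=trg(\alpha)$; $\alpha$ indirectly defeats $\beta\in\mathcal{R}$ iff $\alpha$ directly defeats $src(\beta)$; $\alpha\rightarrow_R V$ ($\alpha$ defeats $V$) iff $\alpha$ directly or indirectly defeats $V$. Only attacks can defeat, i.e. $V\rightarrow_R W$ implies $V\in\mathcal{R}$. AFRA notions, for $\mathcal{S}\subseteq\mathcal{A}\cup\mathcal{R}$: $\mathcal{S}$ is conflict-free iff there are no $V,W\in\mathcal{S}$ with $V\rightarrow_R W$. $W\in\mathcal{A}\cup\mathcal{R}$ is acceptable w.r.t. $\mathcal{S}$ iff for every $\alpha\in\mathcal{R}$ with $\alpha\rightarrow_R W$ there is $\beta\in\mathcal{S}$ with $\beta\rightarrow_R\alpha$; $\mathbb{F}_\Gamma(\mathcal{S})$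 is the set of elements acceptable w.r.t. $\mathcal{S}$. $\mathcal{S}$ is admissible iff it is conflict-free and $\mathcal{S}\subseteq\mathbb{F}_\Gamma(\mathcal{S})$. $\mathcal{S}$ is: a complete extension iff it is admissible and $\mathbb{F}_\Gamma(\mathcal{S})\subseteq\mathcal{S}$; the grounded extension iff it is the least fixed point of $\mathbb{F}_\Gamma$; a preferred extension iff it is a maximal admissible set; a stable extension iff it is conflict-free and every $V\in(\mathcal{A}\cup\mathcal{R})\setminus\mathcal{S}$ satisfies $\alpha\rightarrow_R V$ for some $\alpha\in\mathcal{S}$; a semi-stable extension iff it is a complete extension with maximal range among complete extensions, where $range(\mathcal{S})=\mathcal{S}\cup\{V\in\mathcal{A}\cup\mathcal{R}\mid\exists\alpha\in\mathcal{S},\ \alpha\rightarrow_R V\}$; ideal iff it is admissible and contained in every preferred extension; the ideal extension iff it is the maximal ideal set. (Least and maximal are w.r.t. set inclusion.) Dung notions, for an argumentation framework (AF) $\Delta=\langle X,\rightarrow\rangle$ with $X$ a set and $\rightarrow\subseteq X\times X$, and $\mathcal{U}\subseteq X$: $\mathcal{U}$ is D-conflict-free if there are no $A,B\in\mathcal{U}$ with $(A,B)\in\rightarrow$. $A\in X$ is D-acceptable w.r.t. $\mathcal{U}$ if for all $B\in X$ with $(B,A)\in\rightarrow$ there is $C\in\mathcal{U}$ with $(C,B)\in\rightarrow$; $F_\Delta(\mathcal{U})$ is the set of arguments D-acceptable w.r.t. $\mathcal{U}$. $\mathcal{U}$ is D-admissible if it is D-conflict-free and $\mathcal{U}\subseteq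 F_\Delta(\mathcal{U})$. $\mathcal{U}$ is: a D-complete extension if it is D-admissible and $F_\Delta(\mathcal{U})\subseteq\mathcal{U}$; the D-grounded extension if it is the least fixed point of $F_\Delta$; a D-preferred extension if it is a maximal D-admissible set; a D-stable extension if it is D-conflict-free and for all $A\in X\setminus\mathcal{U}$ there is $B\in\mathcal{U}$ with $(B,A)\in\rightarrow$; a D-semi-stable extension if it is a D-complete extension with maximal D-range among D-complete extensions, the D-range of $\mathcal{U}$ being $\mathcal{U}\cup\{A\in X\mid\exists B\in\mathcal{U},\ (B,A)\in\rightarrow\}$; D-ideal if it is D-admissible and contained in every D-preferred extension; the D-ideal extension if it is the maximal D-ideal set. *)

(* Defs.v *)
From mathcomp Require Import all_boot all_classical.

Set Implicit Arguments.
Unset Strict Implicit.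
Unset Printing Implicit Defensive.

Local Open Scope classical_set_scope.

(* The objects that can be built from a universe U of arguments: an argument,
   or an attack, which is literally a pair (source, target) whose target is
   again such an object. The two constructors keep arguments and attacks
   distinct. *)
Inductive elt (U : Type) : Type :=
| Arg (A : U)
| Att (alpha : U * elt U).

Arguments Arg {U} A.
Arguments Att {U} alpha.

Definition attack (U : Type) : Type := (U * elt U)%type.

Definition src (U : Type) (alpha : attack U) : U := alpha.1.
Definition trg (U : Type) (alpha : attack U) : elt U := alpha.2.

Record AFRA (U : Type) : Type := MkAFRA {
  args : set U;
  attacks : set (attack U);
  src_args : forall alpha, attacks alpha -> args (src alpha);
  trg_elts : forall alpha, attacks alpha ->
    (Att @` attacks) (trg alpha) \/ (Arg @` args) (trg alpha)
}.

Section AFRANotions.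
Variables (U : Type) (G : AFRA U).
Implicit Types (V W : elt U) (alpha beta : attack U) (S : set (elt U)).

Definition afra_elts : set (elt U) := Arg @` args G `|` Att @` attacks G.

Definition directly_defeats alpha V : Prop :=
  [/\ attacks G alpha, afra_elts V & V = trg alpha].

Definition indirectly_defeats alpha beta : Prop :=
  attacks G beta /\ directly_defeats alpha (Arg (src beta)).

(* A relation on all the elements, whose left-hand sides are always attacks of
   the framework. *)
Definition defeats V W : Prop :=
  exists2 alpha, V = Att alpha &
    directly_defeats alpha W \/
    exists2 beta, W = Att beta & indirectly_defeats alpha beta.

Definition conflict_free S : Prop :=
  ~ exists V W, [/\ S V, S W & defeats V W].

Definition acceptable S W : Prop :=
  forall alpha, attacks G alpha -> defeats (Att alpha) W ->
    exists2 V, S V & defeats V (Att alpha).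

Definition charF S : set (elt U) := [set W | afra_elts W /\ acceptable S W].

(* charF S only contains elements of the framework, hence so do the admissible
   sets and the fixed points of charF. *)
Definition admissible S : Prop := conflict_free S /\ S `<=` charF S.

Definition complete_extension S : Prop := admissible S /\ charF S `<=` S.

Definition grounded_extension S : Prop :=
  charF S = S /\ forall S', charF S' = S' -> S `<=` S'.

Definition preferred_extension S : Prop :=
  admissible S /\ forall S', admissible S' -> S `<=` S' -> S' = S.

Definition stable_extension S : Prop :=
  conflict_free S /\
  forall V, (afra_elts `\` S) V -> exists2 W, S W & defeats W V.

Definition afra_range S : set (elt U) :=
  S `|` [set V | afra_elts V /\ exists2 W, S W & defeats W V].

Definition semi_stable_extension S : Prop :=
  complete_extension S /\
  forall S', complete_extension S' -> afra_range S `<=` afra_range S' ->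
    afra_range S' = afra_range S.

Definition ideal S : Prop :=
  admissible S /\ forall S', preferred_extension S' -> S `<=` S'.

Definition ideal_extension S : Prop :=
  ideal S /\ forall S', ideal S' -> S `<=` S' -> S' = S.

End AFRANotions.

Record AF (T : Type) : Type := MkAF {
  dargs : set T;
  datt : set (T * T);
  datt_sub : datt `<=` dargs `*` dargs
}.

Section DungNotions.
Variables (T : Type) (D : AF T).
Implicit Types (A B C : T) (S : set T).

Definition D_conflict_free S : Prop :=
  ~ exists A B, [/\ S A, S B & datt D (A, B)].

Definition D_acceptable S A : Prop :=
  forall B, dargs D B -> datt D (B, A) -> exists2 C, S C & datt D (C, B).

Definition D_charF S : set T := [set A | dargs D A /\ D_acceptable S A].

Definition D_admissible S : Prop := D_conflict_free S /\ S `<=` D_charF S.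

Definition D_complete_extension S : Prop := D_admissible S /\ D_charF S `<=` S.

Definition D_grounded_extension S : Prop :=
  D_charF S = S /\ forall S', D_charF S' = S' -> S `<=` S'.

Definition D_preferred_extension S : Prop :=
  D_admissible S /\ forall S', D_admissible S' -> S `<=` S' -> S' = S.

Definition D_stable_extension S : Prop :=
  D_conflict_free S /\
  forall A, (dargs D `\` S) A -> exists2 B, S B & datt D (B, A).

Definition D_range S : set T :=
  S `|` [set A | dargs D A /\ exists2 B, S B & datt D (B, A)].

Definition D_semi_stable_extension S : Prop :=
  D_complete_extension S /\
  forall S', D_complete_extension S' -> D_range S `<=` D_range S' ->
    D_range S' = D_range S.

Definition D_ideal S : Prop :=
  D_admissible S /\ forall S', D_preferred_extension S' -> S `<=` S'.

Definition D_ideal_extension S : Prop :=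
  D_ideal S /\ forall S', D_ideal S' -> S `<=` S' -> S' = S.

End DungNotions.

Section CorrespondingAF.
Variables (U : Type) (G : AFRA U).

Definition corresponding_att : set (elt U * elt U) :=
  [set VW | [/\ afra_elts G VW.1, afra_elts G VW.2 & defeats G VW.1 VW.2]].

Lemma corresponding_att_sub :
  corresponding_att `<=` afra_elts G `*` afra_elts G.
Proof. by move=> [V W] [GV GW _]; split. Qed.

Definition corresponding_AF : AF (elt U) := MkAF corresponding_att_sub.

End CorrespondingAF.

(* Main.v *)
(* A defeat can only relate two elements of the framework, so the attack
   relation of the corresponding AF is the defeat relation itself, and every
   AFRA notion coincides with its Dung counterpart. *)
Require Import Defs.
From mathcomp Require Import all_boot all_classical.

Local Open Scope classical_set_scope.

Set Implicit Arguments.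
Unset Strict Implicit.
Unset Printing Implicit Defensive.

Section CorrespondingNotions.
Variables (U : Type) (G : AFRA U).
Local Notation D := (corresponding_AF G).

Lemma defeats_attack V W :
  defeats G V W -> exists2 alpha, V = Att alpha & attacks G alpha.
Proof.
by case=> alpha -> alphaW; exists alpha; case: alphaW => [[]|[beta _ [_ []]]].
Qed.

(** A directly defeated [W] lies in the framework by the second conjunct of [directly_defeats]; an
    indirectly defeated one is an attack of [G] by the first conjunct of [indirectly_defeats]. *)
Lemma defeats_afra_elts V W :
  defeats G V W -> afra_elts G V /\ afra_elts G W.
Proof.
move=> VW; split.
  by have [alpha -> Galpha] := defeats_attack VW; right; exists alpha.
by case: VW => alpha _ [[]//|[beta -> [Gbeta _]]]; right; exists beta.
Qed.

Lemma datt_corresponding : datt D = [set VW | defeats G VW.1 VW.2].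
Proof.
apply/seteqP; split=> [[V W] []//|[V W] /= VW].
by have [GV GW] := defeats_afra_elts VW.
Qed.

(** Equality of predicates, rather than an equivalence at a given set, allows rewriting under the
    quantifiers over competing sets [S'] in the later notions. *)
Lemma D_conflict_free_corresponding : D_conflict_free D = conflict_free G.
Proof. by rewrite /D_conflict_free datt_corresponding. Qed.

(** The Dung side quantifies over all elements as attackers, the AFRA side only over attacks; these
    agree because every defeater is an attack of [G]. *)
Lemma D_acceptable_corresponding : D_acceptable D = acceptable G.
Proof.
rewrite /D_acceptable datt_corresponding.
apply/funext => S; apply/funext => W; apply/propext; split=> accW.
  (* [right; exists alpha] shows that [Att alpha] is an argument of [D]. *)
  by move=> alpha Galpha; apply: accW; right; exists alpha.
move=> V _ /= VW; have [alpha Valpha Galpha] := defeats_attack VW.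
by rewrite Valpha in VW *; apply: accW.
Qed.

(** Since [dargs D] is [afra_elts G] by computation, only acceptability has to be rewritten; the
    same conversion serves the stable extensions and the ranges. *)
Lemma D_charF_corresponding : D_charF D = charF G.
Proof. by rewrite /D_charF D_acceptable_corresponding. Qed.

Lemma D_admissible_corresponding : D_admissible D = admissible G.
Proof.
by rewrite /D_admissible D_conflict_free_corresponding D_charF_corresponding.
Qed.

Lemma D_complete_extension_corresponding :
  D_complete_extension D = complete_extension G.
Proof.
by rewrite /D_complete_extension D_admissible_corresponding
  D_charF_corresponding.
Qed.

Lemma D_grounded_extension_corresponding :
  D_grounded_extension D = grounded_extension G.
Proof. by rewrite /D_grounded_extension D_charF_corresponding. Qed.

Lemma D_preferred_extension_corresponding :
  D_preferred_extension D = preferred_extension G.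
Proof. by rewrite /D_preferred_extension D_admissible_corresponding. Qed.

Lemma D_stable_extension_corresponding :
  D_stable_extension D = stable_extension G.
Proof.
by rewrite /D_stable_extension D_conflict_free_corresponding datt_corresponding.
Qed.

Lemma D_range_corresponding : D_range D = afra_range G.
Proof. by rewrite /D_range datt_corresponding. Qed.

Lemma D_semi_stable_extension_corresponding :
  D_semi_stable_extension D = semi_stable_extension G.
Proof.
by rewrite /D_semi_stable_extension D_complete_extension_corresponding
  D_range_corresponding.
Qed.

Lemma D_ideal_corresponding : D_ideal D = ideal G.
Proof.
by rewrite /D_ideal D_admissible_corresponding
  D_preferred_extension_corresponding.
Qed.

Lemma D_ideal_extension_corresponding :
  D_ideal_extension D = ideal_extension G.
Proof. by rewrite /D_ideal_extension D_ideal_corresponding. Qed.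

End CorrespondingNotions.

Theorem proposition12 (U : Type) (G : AFRA U) (S : set (elt U)) (W : elt U)
    (hS : S `<=` afra_elts G) (hW : afra_elts G W) :
  (conflict_free G S <-> D_conflict_free (corresponding_AF G) S) /\
  (acceptable G S W <-> D_acceptable (corresponding_AF G) S W) /\
  (admissible G S <-> D_admissible (corresponding_AF G) S) /\
  (preferred_extension G S <->
     D_preferred_extension (corresponding_AF G) S) /\
  (stable_extension G S <-> D_stable_extension (corresponding_AF G) S) /\
  (complete_extension G S <-> D_complete_extension (corresponding_AF G) S) /\
  (grounded_extension G S <-> D_grounded_extension (corresponding_AF G) S) /\
  (semi_stable_extension G S <->
     D_semi_stable_extension (corresponding_AF G) S) /\
  (ideal_extension G S <-> D_ideal_extension (corresponding_AF G) S).
Proof.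
(* The rewrites make the two sides of each of the nine equivalences identical. *)
rewrite D_conflict_free_corresponding D_acceptable_corresponding.
rewrite D_admissible_corresponding D_preferred_extension_corresponding.
rewrite D_stable_extension_corresponding D_complete_extension_corresponding.
rewrite D_grounded_extension_corresponding.
rewrite D_semi_stable_extension_corresponding.
by rewrite D_ideal_extension_corresponding; do 8 (split=> //).
Qed.
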